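(* Let $\mathfrak g$ be a Lie algebra endowed with an abelian complex structure $J$. Then there exists a unique $J$-semisimple subalgebra $\mathfrak h$ of $\mathfrak g$ such that $$\mathfrak g=\mathfrak h\ltimes \mathrm{Rad}(\mathfrak g,J).$$
   Context: All Lie algebras are finite-dimensional and real. A complex structure on a Lie algebra $\mathfrak g$ is an endomorphism $J$ of $\mathfrak g$ with $J^2=-\mathrm{Id}$ and $[X,Y]+J[JX,Y]+J[X,JY]-[JX,JY]=0$ for all $X,Y\in\mathfrak g$. It is called abelian if $[JX,JY]=[X,Y]$ for all $X,Y\in\mathfrak g$. The $J$-adapted derived series is $\mathfrak g^{[0]}(J)=\mathfrak g$, $\mathfrak g^{[j+1]}(J)=[\mathfrak g^{[j]}(J),\mathfrak g^{[j]}(J)]+J[\mathfrak g^{[j]}(J),\mathfrak g^{[j]}(J)]$. $\mathfrak g$ is $J$-solvable if $\mathfrak g^{[j]}(J)=0$ for some $j$; the notion applies also to $J$-invariant subalgebras and ideals with the restricted complex structure (a $J$-solvable ideal is in particular $J$-invariant). Sums of $J$-solvable ideals are $J$-solvable, and $\mathrm{Rad}(\mathfrak g,J)$ denotes the maximal $J$-solvable ideal of $\mathfrak g$. A Lie algebra with complex structure (in particular a $J$-invariant subalgebra with the restricted complex structure) is $J$-semisimple if it has no non-zero $J$-solvable ideals; the zero algebra is allowed. The notation $\mathfrak g=\mathfrak h\ltimes\mathfrak k$ means that $\mathfrak h$ is a $J$-invariant subalgebra, $\mathfrak k$ is a $J$-invariant ideal, and $\mathfrak g=\mathfrak h\oplus\mathfrak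 k$ as vector spaces. *)

(* Defs.v *)
From HB Require Import structures.
From mathcomp Require Import all_boot all_algebra.
From mathcomp Require Import boolp classical_sets reals.

Set Implicit Arguments.
Unset Strict Implicit.
Unset Printing Implicit Defensive.

Import GRing.Theory.

Local Open Scope ring_scope.

HB.mixin Record isLieAlgebra (R : fieldType) V of Vector R V := {
  lie : V -> V -> V;
  lie_linearr : forall x : V, linear (lie x);
  lie_linearl : forall y : V, linear (lie^~ y);
  liexx : forall x : V, lie x x = 0;
  lie_jacobi : forall x y z : V,
    lie x (lie y z) + lie y (lie z x) + lie z (lie x y) = 0
}.

(* Finite-dimensional by inheritance from [Vector]. *)
#[short(type="lieAlgType")]
HB.structure Definition LieAlgebra (R : fieldType) :=
  { V of isLieAlgebra R V & Vector R V }.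

Section Brackets.
Variables (R : fieldType) (g : lieAlgType R).
Implicit Types (U V W : {vspace g}) (x y : g).

(* The linear span of all [lie u v] with u in U and v in V, see
   [memv_liev] and [liev_subP]. *)
Definition liev U V : {vspace g} :=
  <<[seq lie u v | u <- vbasis U, v <- vbasis V]>>%VS.

HB.instance Definition _ x :=
  GRing.isLinear.Build R g g _ (lie x) (lie_linearr x).

Lemma lieDl x y z : lie (x + y) z = lie x z + lie y z.
Proof. by have := lie_linearl z 1 x y; rewrite !scale1r. Qed.

Lemma lieC x y : lie x y = - lie y x.
Proof.
have := liexx (x + y); rewrite lieDl !linearD /= !liexx add0r addr0.
by move/eqP; rewrite addr_eq0 => /eqP.
Qed.

Lemma lie_suml I (r : seq I) (F : I -> g) (a : I -> R) y :
  lie (\sum_(i <- r) a i *: F i) y = \sum_(i <- r) a i *: lie (F i) y.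
Proof.
elim: r => [|i r IHr]; first by rewrite !big_nil lieC linear0 oppr0.
by rewrite !big_cons -IHr; apply: lie_linearl.
Qed.

Lemma memv_liev U V u v : u \in U -> v \in V -> lie u v \in liev U V.
Proof.
move=> /coord_vbasis-> /coord_vbasis->; rewrite lie_suml.
apply: memv_suml => i _; rewrite memvZ // linear_sum.
apply: memv_suml => j _; rewrite linearZ memvZ //.
by apply/memv_span/allpairs_f; rewrite mem_nth ?size_tuple.
Qed.

Lemma liev_subP {U V W} :
  reflect (forall u v, u \in U -> v \in V -> lie u v \in W)
          (liev U V <= W)%VS.
Proof.
apply: (iffP idP) => [sUVW u v Uu Vv | sUVW].
  exact: subvP sUVW _ (memv_liev Uu Vv).
apply/span_subvP => _ /allpairsP[[u v] /= [Uu Vv ->]].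
by apply: sUVW; apply: vbasis_mem.
Qed.

End Brackets.

Section ComplexStructures.
Variables (R : fieldType) (g : lieAlgType R) (J : 'End(g)).
Implicit Types (h k U V : {vspace g}).

Definition complex_structure : Prop :=
  (forall x : g, J (J x) = - x) /\
  (forall x y : g,
     lie x y + J (lie (J x) y) + J (lie x (J y)) - lie (J x) (J y) = 0).

Definition abelian_complex_structure : Prop :=
  complex_structure /\ (forall x y : g, lie (J x) (J y) = lie x y).

Definition Jinvariant U : bool := (J @: U <= U)%VS.

Definition Jsubalgebra h : bool := Jinvariant h && (liev h h <= h)%VS.

(* k is a J-invariant ideal of the subalgebra h. *)
Definition Jideal h k : bool :=
  [&& (k <= h)%VS, Jinvariant k & (liev h k <= k)%VS].

Fixpoint Jderived U (j : nat) : {vspace g} :=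
  if j is j'.+1 then
    let D := liev (Jderived U j') (Jderived U j') in (D + J @: D)%VS
  else U.

Definition Jsolvable U : Prop := exists j, Jderived U j = 0%VS.

Definition Jsolvable_ideal h k : Prop := Jideal h k /\ Jsolvable k.

Definition Jsemisimple h : Prop :=
  Jsubalgebra h /\ (forall k, Jsolvable_ideal h k -> k = 0%VS).

Definition is_JRad (r : {vspace g}) : Prop :=
  Jsolvable_ideal fullv r /\
  (forall k, Jsolvable_ideal fullv k -> (k <= r)%VS).

(* The default value of [xget] is never used, see [JRadP]. *)
Definition JRad : {vspace g} := xget 0%VS [set r | is_JRad r]%classic.

Definition semidirect h k : Prop :=
  [/\ Jsubalgebra h, Jideal fullv k, (h + k)%VS = fullv & (h :&: k)%VS = 0%VS].

Lemma JderivedS U V j : (U <= V)%VS -> (Jderived U j <= Jderived V j)%VS.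
Proof.
move=> sUV; elim: j => //= j IHj.
have sD : (liev (Jderived U j) (Jderived U j) <=
           liev (Jderived V j) (Jderived V j))%VS.
  by apply/liev_subP => u v Uu Uv; apply: memv_liev; apply: (subvP IHj).
by apply: addvS => //; apply: limgS.
Qed.

Lemma Jderived_add U i j : Jderived U (i + j) = Jderived (Jderived U i) j.
Proof. by elim: j => [|j IHj]; rewrite ?addn0 // addnS /= IHj. Qed.

Lemma Jderived_addv U V j :
  Jideal fullv V -> (Jderived (U + V) j <= Jderived U j + V)%VS.
Proof.
move=> /and3P[_ JV /liev_subP iV]; elim: j => //= j IHj.
set D := liev (Jderived U j) _; set E := liev _ _.
have sE : (E <= D + V)%VS.
  apply/liev_subP => u v /(subvP IHj u)/memv_addP[a Ua [b Vb ->]].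
  move=> /(subvP IHj v)/memv_addP[c Uc [d Vd ->]].
  rewrite linearD /= !lieDl -addrA.
  apply: memv_add; first exact: memv_liev.
  have Vbc : lie b c \in V by rewrite lieC memvN; apply: iV; rewrite ?memvf.
  by rewrite !memvD //; apply: iV; rewrite ?memvf.
rewrite subv_add; apply/andP; split.
  by apply: subv_trans sE _; apply: addvS => //; apply: addvSl.
apply: subv_trans (limgS J sE) _; rewrite limgD.
by apply: addvS => //; apply: addvSr.
Qed.

Lemma Jsolvable_ideal0 : Jsolvable_ideal fullv 0%VS.
Proof.
split; last by exists 0%N.
rewrite /Jideal sub0v /Jinvariant limg0 sub0v /=.
by apply/liev_subP => u v _; rewrite memv0 => /eqP->; rewrite linear0 mem0v.
Qed.

Lemma Jsolvable_ideal_add U V :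
  Jsolvable_ideal fullv U -> Jsolvable_ideal fullv V ->
  Jsolvable_ideal fullv (U + V)%VS.
Proof.
move=> [iU [m U0]] [iV [n V0]]; split.
  have [/and3P[_ JU /liev_subP lU] /and3P[_ JV /liev_subP lV]] := (iU, iV).
  apply/and3P; split; first exact: subvf.
    by rewrite /Jinvariant limgD; apply: addvS.
  apply/liev_subP => x _ _ /memv_addP[a Ua [b Vb ->]]; rewrite linearD /=.
  by apply: memv_add; [apply: lU|apply: lV]; rewrite ?memvf.
exists (m + n)%N; rewrite Jderived_add.
have sV : (Jderived (U + V) m <= V)%VS.
  by have := Jderived_addv U m iV; rewrite U0 add0v.
by have := JderivedS n sV; rewrite V0 subv0 => /eqP.
Qed.

Lemma JRadP : is_JRad JRad.
Proof.
apply: (@xgetPex _ 0%VS [set r | is_JRad r]%classic).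
pose P n := `[< exists2 k, Jsolvable_ideal fullv k & \dim k = n >].
have exP : exists n, P n.
  exists 0%N; apply/asboolP; exists 0%VS; last exact: dimv0.
  exact: Jsolvable_ideal0.
have ubP n : P n -> (n <= \dim {:g})%N.
  by move=> /asboolP[k _ <-]; apply/dimvS/subvf.
case: (ex_maxnP exP ubP) => n /asboolP[r sr dr] maxn.
exists r; split=> // k sk; have srk := Jsolvable_ideal_add sr sk.
have /maxn le_n : P (\dim (r + k)) by apply/asboolP; exists (r + k)%VS.
have /eqP-> : r == (r + k)%VS by rewrite eqEdim addvSl dr.
exact: addvSr.
Qed.

End ComplexStructures.

(* Main.v *)
(* Since g^{1,0} and g^{0,1} are abelian, the computation of Ito's theorem on
   products of two abelian subgroups shows that the derived algebra A = [g,g] is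
   abelian. Hence all ad x commute on A, and u * v = [J u, v] makes A a
   commutative associative algebra. Its Wedderburn decomposition A = S + N (N the
   nilradical, S the unique maximal reduced subalgebra, with unit e) yields the
   decomposition of g: a J-solvable ideal meets A in nilpotent elements, the set
   of x with [A,x] and [JA,x] contained in N is a J-solvable ideal, and
   x - [Je,x] + J[e,x] belongs to it for every x, so that h = S + JS is a
   complement of the radical. Conversely, if h' is any complement, then
   A = [h',h'] + N with [h',h'] reduced; therefore S = [h',h'], and h' = h. *)

From HB Require Import structures.
Require Import Defs.
From mathcomp Require Import all_boot all_algebra all_field reals.
From mathcomp Require Import boolp zify ring.
From mathcomp Require Import complex.
Set Implicit Arguments.
Unset Strict Implicit.
Unset Printing Implicit Defensive.

Import GRing.Theory Num.Theory.
Local Open Scope ring_scope.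

(** * Separable polynomials and Newton's iteration in characteristic zero *)

Section Polynomials.
Variable F : numFieldType.
Implicit Types p q r h : {poly F}.

Lemma comp_poly_taylor1 q r h :
  exists s, q \Po (r + h) = q \Po r + (q^`() \Po r) * h + s * h ^+ 2.
Proof.
elim/poly_ind: q => [|q c [s IHq]].
  by exists 0; rewrite deriv0 !comp_poly0 !mul0r !addr0.
exists (s * (r + h) + (q^`() \Po r)).
rewrite derivMXaddC !comp_poly_MXaddC comp_polyD comp_polyM comp_polyX IHq.
by ring.
Qed.

(* Newton's iteration r - q(r) / q'(r), where 1 / q' is a Bezout cofactor. *)
Lemma separable_newton q k : separable_poly q ->
  exists r, (q %| r - 'X) && (q ^+ k.+1 %| q \Po r).
Proof.
rewrite unlock => /Bezout_eq1_coprimepP[[a b] /= ab1].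
elim: k => [|k [r /andP[/dvdpP[c cP] /dvdpP[d dP]]]].
  by exists 'X; rewrite subrr dvdp0 comp_polyXr expr1 dvdpp.
have ab1r : (a \Po r) * (q \Po r) + (b \Po r) * (q^`() \Po r) = 1.
  by rewrite -!comp_polyM -comp_polyD ab1 comp_polyC.
have [s sP] := comp_poly_taylor1 q r (- ((q \Po r) * (b \Po r))).
have qr : q %| q \Po r.
  by apply/dvdpP; exists (d * q ^+ k); rewrite dP exprS; ring.
exists (r - (q \Po r) * (b \Po r)); apply/andP; split.
  rewrite addrAC cP; apply: dvdp_sub; first exact: dvdp_mull.
  exact: dvdp_mulr.
(* By Bezout, [1 - b q'] at [r] equals [a q] at [r], so the new value is a multiple of the square of
   the old one; one more factor [q] is all that is kept. *)
have -> : q \Po (r - (q \Po r) * (b \Po r)) =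
    (q \Po r) ^+ 2 * ((a \Po r) + s * (b \Po r) ^+ 2).
  rewrite sP -[X in X + _ * _ + _]mulr1 -ab1r; ring.
apply: dvdp_mulr; rewrite expr2 exprS.
by apply: dvdp_mul => //; rewrite dP dvdp_mulIr.
Qed.

(** Induction on the degree: a non-separable [p] is the product of [d = gcd(p, p')] and [p / d],
    both of smaller degree. The lcm of the separable polynomials found for these two factors is
    separable and serves for [p]. *)
Lemma separable_radical p : p != 0 ->
  exists q k, separable_poly q /\ p %| q ^+ k.
Proof.
have [n] := ubnP (size p); elim: n p => // n IHn p ltpn p0.
have [p1|p1] := leqP (size p) 1.
  exists 1, 0%N; rewrite unlock coprime1p; split=> //.
  have /size_poly1P[c c0 ->] : size p == 1%N by rewrite eqn_leq p1 size_poly_gt0.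
  by rewrite expr0 -(alg_polyC c) dvdpZl.
have [sp|nsp] := boolP (separable_poly p); first by exists p, 1%N.
have dp0 : p^`() != 0.
  have [m pm] : exists m, size p = m.+2 by exists (size p).-2; lia.
  apply/eqP => /(congr1 (fun q : {poly F} => q`_m)) /eqP.
  rewrite coef_deriv coef0 mulrn_eq0 /=; apply/negP.
  by move: p0; rewrite -lead_coef_eq0 lead_coefE pm.
set d := gcdp p p^`().
have d0 : d != 0 by rewrite gcdp_eq0 (negPf p0).
have d1 : (1 < size d)%N.
  rewrite ltn_neqAle eq_sym size_poly_gt0 d0 andbT.
  by move: nsp; rewrite unlock.
have ltd : (size d < size p)%N.
  by apply: leq_ltn_trans (leq_gcdpr _ dp0) (lt_size_deriv p0).
have pE : p = p %/ d * d by rewrite divpK ?dvdp_gcdl.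
set p2 := p %/ d in pE.
have ltp2 : (size p2 < size p)%N.
  by rewrite size_divp // ltn_subrL size_poly_gt0 p0 andbT;
    case: (size d) d1 => [|[]].
have p20 : p2 != 0 by apply: contraNneq p0 => p20; rewrite pE p20 mul0r.
have [q1 [k1 [s1 dv1]]] := IHn _ (leq_trans ltp2 ltpn) p20.
have [q2 [k2 [s2 dv2]]] := IHn _ (leq_trans ltd ltpn) d0.
set g := gcdp q1 q2.
have q2E : q2 = q2 %/ g * g by rewrite divpK ?dvdp_gcdr.
have q1E : q1 = q1 %/ g * g by rewrite divpK ?dvdp_gcdl.
have q10 : q1 != 0.
  by apply: contraTneq s1 => ->; rewrite unlock /coprimep deriv0 gcdp0 size_poly0.
have g0 : g != 0 by rewrite gcdp_eq0 (negPf q10).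
exists (q1 * (q2 %/ g)), (k1 + k2)%N; split.
  move: (s2); rewrite {1}q2E separable_mul => /and3P[s2' _ cg].
  rewrite separable_mul s1 s2' q1E coprimepMl (coprimep_sym g) cg andbT.
  by rewrite coprimep_div_gcd // q10.
rewrite pE exprD dvdp_mul //.
  by apply: dvdp_trans dv1 _; apply: dvdp_exp2r; apply: dvdp_mulIl.
apply: dvdp_trans dv2 _; apply: dvdp_exp2r.
rewrite {1}q2E mulrC; apply: dvdp_mul => //; exact: dvdp_gcdl.
Qed.

End Polynomials.

(** * Jordan-Chevalley and Fitting decompositions by polynomials without constant term *)

Section Matrices.
Variables (F : numFieldType) (n : nat).
Implicit Types (M E : 'M[F]_n.+1) (p q r : {poly F}).

Lemma horner_mx_comp M p q :
  horner_mx M (p \Po q) = horner_mx (horner_mx M q) p.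
Proof.
elim/poly_ind: p => [|p c IHp]; first by rewrite comp_poly0 !rmorph0.
rewrite comp_poly_MXaddC !rmorphD !rmorphM /= IHp.
by rewrite !horner_mx_C horner_mx_X.
Qed.

Lemma horner_mx_dvdp_eq0 M p q : p %| q -> horner_mx M p = 0 -> horner_mx M q = 0.
Proof. by move=> /dvdpP[d ->] p0; rewrite rmorphM /= p0 mulr0. Qed.

Lemma root0_dvdX p : root p 0 = ('X %| p).
Proof. by rewrite -['X]subr0 -(polyC0) dvdp_XsubCl. Qed.

(** Newton's iteration starting from ['X] yields the semisimple part as [r] evaluated at [M]. The
    condition [root r 0] keeps it in the algebra without unit generated by [M]. *)
Lemma mx_jordan_chevalley M : exists q r,
  [/\ separable_poly q, root r 0, horner_mx (horner_mx M r) q = 0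
    & exists k, (M - horner_mx M r) ^+ k = 0].
Proof.
(* The extra factor ['X] makes 0 a root of [q], hence of [r], which is congruent to ['X] modulo
   [q]. *)
have p0 : 'X * mxminpoly M != 0.
  by rewrite mulf_neq0 ?polyX_eq0 ?monic_neq0 ?mxminpoly_monic.
have [q [k [sq dv]]] := separable_radical p0.
have Xq : root q 0.
  have /(dvdp_trans (dvdp_mulIl _ _)) := dv.
  by rewrite -root0_dvdX rootE horner_exp expf_eq0 => /andP[_].
have qMk : horner_mx M (q ^+ k.+1) = 0.
  apply: horner_mx_dvdp_eq0 (mx_root_minpoly M).
  rewrite exprS; apply: dvdp_mull; apply: dvdp_trans dv.
  exact: dvdp_mulIr.
have [r /andP[/dvdpP[c rX] dvr]] := separable_newton k sq.
have rE : r = 'X + c * q by rewrite -rX addrC subrK.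
exists q, r; split=> //.
- by rewrite rE rootE hornerD hornerM hornerX (rootP Xq) mulr0 addr0.
- by rewrite -horner_mx_comp; apply: horner_mx_dvdp_eq0 dvr qMk.
exists k.+1; rewrite rE rmorphD /= horner_mx_X opprD addNKr.
rewrite -rmorphN -rmorphXn /= -mulNr exprMn rmorphM /= qMk mulr0 //.
Qed.

(** Split the minimal polynomial as [q * 'X^k] with [q] not vanishing at 0. A Bezout relation gives
    the projection onto the Fitting component on which [M] is invertible; it is zero only if [M] is
    nilpotent. *)
Lemma mx_fitting_idempotent M : (forall k, M ^+ k != 0) ->
  exists2 r, root r 0 &
  horner_mx M r * horner_mx M r = horner_mx M r /\ horner_mx M r != 0.
Proof.
move=> nnM; set p := mxminpoly M.
have p0 : p != 0 by rewrite monic_neq0 ?mxminpoly_monic.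
have [k [q nq pE]] := multiplicity_XsubC p 0.
rewrite subr0 p0 /= in nq pE.
(* The exponent [k.+1] instead of [k] guarantees a root at 0 even when [M] is invertible. *)
have cq : coprimep q ('X^(k.+1)).
  by rewrite coprimep_pexpr // -['X]subr0 -polyC0 coprimep_XsubC.
have /Bezout_eq1_coprimepP[[a b] /= ab] := cq.
have qX : horner_mx M (q * 'X^(k.+1)) = 0.
  apply: horner_mx_dvdp_eq0 (mx_root_minpoly M).
  by rewrite -/p pE exprS; apply: dvdp_mul => //; exact: dvdp_mulIr.
exists (b * 'X^(k.+1)).
  by rewrite rootE hornerM hornerXn expr0n mulr0.
set E := horner_mx M _; split.
  have : horner_mx M (a * q + b * 'X^(k.+1)) = 1 by rewrite ab rmorph1.
  rewrite rmorphD /= -/E => aE; rewrite -[RHS]mul1r -aE mulrDl.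
  have -> : horner_mx M (a * q) * E = 0.
    by rewrite -rmorphM mulrACA rmorphM /= qX mulr0.
  by rewrite add0r.
apply/eqP => E0; have := nnM k.+1; rewrite -(horner_mx_X M) -rmorphXn /=.
rewrite -['X^(k.+1)]mul1r -ab mulrDl -mulrA rmorphD rmorphM /= qX mulr0.
by rewrite add0r rmorphM /= -/E E0 mul0r eqxx.
Qed.

Lemma mx_nilpotentD M1 M2 k1 k2 : GRing.comm M1 M2 ->
  M1 ^+ k1 = 0 -> M2 ^+ k2 = 0 -> (M1 + M2) ^+ (k1 + k2) = 0.
Proof.
move=> cM n1 n2; rewrite exprDn_comm // big1 // => i _.
have [lei|/ltnW lei] := leqP k2 i.
  by rewrite -(subnK lei) exprD n2 !mulr0 mul0rn.
have lek : (k1 <= k1 + k2 - i)%N by rewrite -addnBA // leq_addr.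
by rewrite -(subnK lek) exprD n1 mulr0 mul0r mul0rn.
Qed.

End Matrices.

(** * Semisimple matrices over a field that need not be closed *)

Section Semisimple.
Variables (F : numFieldType) (C : closedFieldType) (f : {rmorphism F -> C}).
Variable n : nat.
Implicit Types (M N : 'M[F]_n.+1).

(** Semisimplicity is tested after extension of scalars, where commuting semisimple matrices can be
    diagonalized simultaneously. *)
Definition semisimple_mx M := diagonalizable (map_mx f M).

Lemma separable_semisimple M q :
  separable_poly q -> horner_mx M q = 0 -> semisimple_mx M.
Proof.
move=> sq qM0; apply/diagonalizableP.
have [rs qE] := closed_field_poly_normal (map_poly f q).
have q0 : lead_coef (map_poly f q) != 0.
  rewrite lead_coef_eq0 map_poly_eq0; apply: contraTneq sq => ->.
  by rewrite unlock /coprimep deriv0 gcdp0 size_poly0.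
have eq_q : map_poly f q %= \prod_(z <- rs) ('X - z%:P) by rewrite qE eqp_scale.
exists rs.
  by rewrite -separable_prod_XsubC -(eqp_separable eq_q) separable_map.
rewrite -(eqp_dvdr _ eq_q); apply: mxminpoly_min.
by rewrite -map_horner_mx qM0 map_mx0.
Qed.

Lemma semisimple_commP M N : M * N = N * M ->
  semisimple_mx M -> semisimple_mx N ->
  exists2 P, P \in unitmx & is_diag_mx (conjmx P (map_mx f M))
    /\ is_diag_mx (conjmx P (map_mx f N)).
Proof.
move=> cMN sM sN.
suff [P uP /= /and3P[dM dN _]] : codiagonalizable [:: map_mx f M; map_mx f N].
  by exists P.
apply/codiagonalizableP; split=> [A B|A].
  rewrite !inE => /orP[]/eqP-> /orP[]/eqP->; rewrite /comm_mx -!map_mxM //;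
  by congr map_mx.
by rewrite !inE => /orP[]/eqP->.
Qed.

Lemma semisimpleD M N : M * N = N * M ->
  semisimple_mx M -> semisimple_mx N -> semisimple_mx (M + N).
Proof.
move=> c sM sN.
have [P uP [/is_diag_mxP dM /is_diag_mxP dN]] := semisimple_commP c sM sN.
exists P => //; apply/is_diag_mxP => i j ij.
by rewrite /conjmx map_mxD mulmxDr mulmxDl mxE -!/(conjmx _ _) dM // dN // addr0.
Qed.

Lemma semisimpleM M N : M * N = N * M ->
  semisimple_mx M -> semisimple_mx N -> semisimple_mx (M * N).
Proof.
move=> c sM sN.
have [P uP [/diag_mxP[d dM] /diag_mxP[e dN]]] := semisimple_commP c sM sN.
exists P => //; rewrite /similar_to map_mxM conjmxM ?inE ?stablemx_unit //.
by rewrite dM dN mulmx_diag diag_mx_is_diag.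
Qed.

Lemma semisimpleZ a M : semisimple_mx M -> semisimple_mx (a *: M).
Proof.
move=> [P uP /is_diag_mxP dM]; exists P => //; apply/is_diag_mxP => i j ij.
by rewrite /conjmx map_mxZ -scalemxAr -scalemxAl mxE -/(conjmx _ _) dM // mulr0.
Qed.

Lemma semisimple0 : semisimple_mx 0.
Proof. by rewrite /semisimple_mx map_mx0; apply: diagonalizable0. Qed.

Lemma semisimple_nilpotent_eq0 M k : semisimple_mx M -> M ^+ k = 0 -> M = 0.
Proof.
move=> [P uP /diag_mxP[d dM]] Mk.
have powE j : conjmx P (map_mx f (M ^+ j)) = diag_mx (map_mx (fun x => x ^+ j) d).
  elim: j => [|j IHj].
    rewrite expr0 map_mx1 conjmx_scalar ?row_free_unit //.
    by apply/matrixP => a b; rewrite !mxE expr0.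
  rewrite exprS map_mxM conjmxM ?inE ?stablemx_unit // dM IHj mulmx_diag.
  by congr diag_mx; apply/rowP => a; rewrite !mxE exprS.
have d0 : d = 0.
  apply/rowP => i; have /matrixP/(_ i i) := powE k.
  rewrite Mk map_mx0 conjmx0 !mxE eqxx mulr1n => /esym/eqP.
  by rewrite expf_eq0 => /andP[_ /eqP].
apply/eqP; rewrite -(map_mx_eq0 f) -(conjmxK (map_mx f M) uP) dM d0.
by rewrite linear0 conjmx0.
Qed.

End Semisimple.

(** Among the subspaces contained in [P], one of maximal dimension absorbs every vector of [P]. *)
Lemma vspace_of_Prop (F : fieldType) (V : vectType F) (P : V -> Prop) :
  P 0 -> (forall a u v, P u -> P v -> P (a *: u + v)) ->
  exists U : {vspace V}, forall u, u \in U <-> P u.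
Proof.
move=> P0 PD.
pose sub (U : {vspace V}) := forall u, u \in U -> P u.
pose Q n := `[< exists2 U, sub U & \dim U = n >].
have exQ : exists n, Q n.
  exists 0%N; apply/asboolP; exists 0%VS; last exact: dimv0.
  by move=> u; rewrite memv0 => /eqP->.
have ubQ n : Q n -> (n <= \dim {:V})%N.
  by move=> /asboolP[U _ <-]; apply/dimvS/subvf.
case: (ex_maxnP exQ ubQ) => n /asboolP[U sU dU] maxn.
exists U => u; split=> [/sU//|Pu].
have /maxn : Q (\dim (U + <[u]>)).
  apply/asboolP; exists (U + <[u]>)%VS => //.
  move=> _ /memv_addP[v Uv [_ /vlineP[a ->] ->]].
  by rewrite addrC; apply: PD => //; apply: sU.
rewrite -dU => le_d; have /eqP-> : U == (U + <[u]>)%VS by rewrite eqEdim addvSl.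
by apply: (subvP (addvSr _ _)); apply: memv_line.
Qed.

(** * Commutative algebras, possibly without unit, in a faithful matrix representation *)

Section MatrixModel.
Variables (F : numFieldType) (C : closedFieldType) (f : {rmorphism F -> C}).
Variables (V : vectType F) (n : nat) (phi : {linear V -> 'M[F]_n.+1}).
Variables (mul : V -> V -> V) (A : {vspace V}).

Definition mul_closed (U : {vspace V}) :=
  forall u v, u \in U -> v \in U -> mul u v \in U.

Hypothesis phi_inj : injective phi.
Hypothesis mul_A : mul_closed A.
Hypothesis phiM : forall u v, u \in A -> v \in A -> phi (mul u v) = phi u * phi v.
Hypothesis phiC : forall u v, u \in A -> v \in A -> phi u * phi v = phi v * phi u.

Definition nilpotent_elt u := exists k, phi u ^+ k = 0.
Definition semisimple_elt u := semisimple_mx f (phi u).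

Lemma nilpotent_eltP a u v : u \in A -> v \in A ->
  nilpotent_elt u -> nilpotent_elt v -> nilpotent_elt (a *: u + v).
Proof.
move=> Au Av [j uj] [k vk]; exists (j + k)%N; rewrite linearP.
apply: mx_nilpotentD => //; last by rewrite exprZn uj scaler0.
by rewrite /GRing.comm -scalerAl -scalerAr phiC.
Qed.

Lemma semisimple_eltP a u v : u \in A -> v \in A ->
  semisimple_elt u -> semisimple_elt v -> semisimple_elt (a *: u + v).
Proof.
move=> Au Av su sv; rewrite /semisimple_elt linearP.
apply: semisimpleD => //; last exact: semisimpleZ.
by rewrite -scalerAl -scalerAr phiC.
Qed.

Lemma semisimple_elt_mul u v : u \in A -> v \in A ->
  semisimple_elt u -> semisimple_elt v -> semisimple_elt (mul u v).
Proof.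
move=> Au Av su sv; rewrite /semisimple_elt phiM //.
by apply: semisimpleM => //; rewrite phiC.
Qed.

Lemma semisimple_nilpotent_elt_eq0 u :
  semisimple_elt u -> nilpotent_elt u -> u = 0.
Proof.
move=> su [k uk]; apply: phi_inj; rewrite linear0.
exact: semisimple_nilpotent_eq0 su uk.
Qed.

(** Without a constant term, [r] involves only positive powers of [u], which stay in [U]. *)
Lemma horner_elt (U : {vspace V}) u r : (U <= A)%VS -> mul_closed U ->
  u \in U -> root r 0 -> exists2 w, w \in U & phi w = horner_mx (phi u) r.
Proof.
move=> UA mulU Uu; rewrite root0_dvdX => /Pdiv.Field.dvdpP[q ->].
elim/poly_ind: q => [|q c [w Uw wE]].
  by exists 0; rewrite ?mem0v // mul0r !linear0.
exists (mul w u + c *: u); first by rewrite memvD ?memvZ ?mulU.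
rewrite linearD linearZ phiM ?(subvP UA) // wE mulrDl rmorphD !rmorphM /=.
by rewrite horner_mx_C horner_mx_X [c%:M * _]mul_scalar_mx.
Qed.

(** Having the semisimple part inside the given subalgebra [U], not just in [A], is what later makes
    the reduced subalgebra unique. *)
Lemma jordan_chevalley_elt (U : {vspace V}) u : (U <= A)%VS -> mul_closed U ->
  u \in U -> exists s, [/\ s \in U, semisimple_elt s & nilpotent_elt (u - s)].
Proof.
move=> UA mulU Uu; have [q [r [sq r0 qr0 [k nk]]]] := mx_jordan_chevalley (phi u).
have [s Us sE] := horner_elt UA mulU Uu r0.
exists s; split=> //; first by apply: separable_semisimple sq _; rewrite sE.
by exists k; rewrite linearB /= sE.
Qed.

(** Take [e] of maximal rank. If [u - e u] were not nilpotent, its Fitting idempotent would be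
    orthogonal to [e], and adding it would raise the rank. *)
Lemma principal_idempotent : exists e, [/\ e \in A, phi e * phi e = phi e
  & forall u, u \in A -> nilpotent_elt (u - mul e u)].
Proof.
pose Q m :=
  `[< exists e, [/\ e \in A, phi e * phi e = phi e & \rank (phi e) = m] >].
have exQ : exists m, Q m.
  exists 0%N; apply/asboolP; exists 0; rewrite mem0v linear0 mul0r.
  by split=> //; apply: mxrank0.
have ubQ m : Q m -> (m <= n.+1)%N.
  by move=> /asboolP[e [_ _ <-]]; apply: rank_leq_row.
case: (ex_maxnP exQ ubQ) => m /asboolP[e [Ae ee re]] maxm.
exists e; split=> // u Au; set v := u - mul e u.
have Av : v \in A by rewrite memvB ?mul_A.
have ev : phi e * phi v = 0.
  by rewrite linearB /= phiM // mulrBr mulrA ee subrr.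
apply: contrapT => nv.
have [|r r0 [GG G0]] := @mx_fitting_idempotent _ _ (phi v).
  by move=> k; apply/eqP => vk; apply: nv; exists k.
have [w Aw wE] := horner_elt (subvv A) mul_A Av r0.
rewrite -wE in GG G0.
have ew : phi e * phi w = 0.
  move: r0; rewrite root0_dvdX => /Pdiv.Field.dvdpP[q rE].
  by rewrite phiC // wE rE rmorphM /= horner_mx_X -mulrA (phiC Av) // ev mulr0.
have we : phi w * phi e = 0 by rewrite phiC.
have ewE : phi (e + w) = phi e + phi w by rewrite linearD.
have /maxm : Q (\rank (phi (e + w))).
  apply/asboolP; exists (e + w); split=> //; first by rewrite memvD.
  by rewrite ewE mulrDl !mulrDr ee ew we GG add0r addr0.
have e_sub : (phi e <= phi (e + w)%R)%MS.
  by apply/submxP; exists (phi e); rewrite ewE [_ *m _]mulrDr ee ew addr0.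
have w_sub : (phi w <= phi (e + w)%R)%MS.
  by apply/submxP; exists (phi w); rewrite ewE [_ *m _]mulrDr GG we add0r.
(* Maximality makes the row spaces of [e] and [e + w] equal, so [w = D e] and
   [w = w w = D e w = 0]. *)
rewrite -re (geq_leqif (mxrank_leqif_sup e_sub)).
move=> /(submx_trans w_sub)/submxP[D wD].
by move: G0; rewrite -GG {1}wD -mulrA ew mulr0 eqxx.
Qed.

End MatrixModel.

Section Coordinates.
Variables (F : fieldType) (V : vectType F).
Implicit Types x y : V.

Definition vcoord x i : F := coord (vbasis fullv) i x.

Lemma vcoord_inj x y : (forall i, vcoord x i = vcoord y i) -> x = y.
Proof.
move=> xy; rewrite (coord_vbasis (memvf x)) (coord_vbasis (memvf y)).
by apply: eq_bigr => i _; rewrite -!/(vcoord _ _) xy.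
Qed.

Lemma vcoordD x y i : vcoord (x + y) i = vcoord x i + vcoord y i.
Proof. by rewrite /vcoord linearD. Qed.

Lemma vcoordN x i : vcoord (- x) i = - vcoord x i.
Proof. by rewrite /vcoord linearN. Qed.

Lemma vcoordZ a x i : vcoord (a *: x) i = a * vcoord x i.
Proof. by rewrite /vcoord linearZ. Qed.

Lemma vcoord0 i : vcoord 0 i = 0.
Proof. by rewrite /vcoord linear0. Qed.

End Coordinates.

(* [ring] is not available on modules, so equalities of linear combinations
   are checked coordinatewise. *)
Ltac vect_ring :=
  apply: vcoord_inj => ?; rewrite ?(vcoordD, vcoordN, vcoordZ, vcoord0); ring.

Section LieBasics.
Variables (F : fieldType) (g : lieAlgType F).
Implicit Types (x y z : g).

Lemma lieNl x y : lie (- x) y = - lie x y.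
Proof. by rewrite [LHS]lieC [in RHS]lieC linearN. Qed.

Lemma lieDr x y z : lie x (y + z) = lie x y + lie x z.
Proof. exact: linearD. Qed.

Lemma lieNr x y : lie x (- y) = - lie x y.
Proof. exact: linearN. Qed.

Lemma lie0l y : lie 0 y = 0.
Proof. by rewrite lieC linear0 oppr0. Qed.

Lemma lieZl a x y : lie (a *: x) y = a *: lie x y.
Proof. by rewrite lieC [in RHS]lieC linearZ scalerN. Qed.

Lemma lieA x y z : lie (lie x y) z = lie x (lie y z) - lie y (lie x z).
Proof.
have := lie_jacobi x y z; rewrite [lie z (lie x y)]lieC [lie z x]lieC linearN /=.
by move/eqP; rewrite subr_eq0 => /eqP.
Qed.

End LieBasics.

(** * The complexified Lie algebra *)

Section Complexification.
Variables (F : fieldType) (g : lieAlgType F).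
Implicit Types a b c : (g * g)%type.

(** The pair [(v, w)] stands for v + i w with i^2 = -1. *)
Definition clie a b : g * g :=
  (lie a.1 b.1 - lie a.2 b.2, lie a.1 b.2 + lie a.2 b.1).

Lemma clieDl a b c : clie (a + b) c = clie a c + clie b c.
Proof. by congr pair; rewrite /= !lieDl; vect_ring. Qed.

Lemma clieC a b : clie a b = - clie b a.
Proof.
by congr pair; rewrite /= ![lie b.1 _]lieC ![lie b.2 _]lieC; vect_ring.
Qed.

Lemma clieDr a b c : clie a (b + c) = clie a b + clie a c.
Proof. by rewrite clieC clieDl opprD -!clieC. Qed.

Lemma clie0l a : clie 0 a = 0.
Proof. by rewrite /clie /= !lie0l subr0 addr0. Qed.

Lemma clie0r a : clie a 0 = 0.
Proof. by rewrite clieC clie0l oppr0. Qed.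

Lemma clieA a b c : clie (clie a b) c = clie a (clie b c) - clie b (clie a c).
Proof.
congr pair; rewrite /= !(lieDl, lieNl, lieDr, lieNr) /= !lieA; vect_ring.
Qed.

End Complexification.

(** * The derived algebra of an abelian complex structure is abelian *)

Section AbelianComplexStructure.
Variables (F : numFieldType) (g : lieAlgType F) (J : 'End(g)).
Hypothesis abJ : abelian_complex_structure J.
Implicit Types (x y z w : g).

Lemma JJ x : J (J x) = - x.
Proof. by case: abJ => [[]]. Qed.

Lemma lieJJ x y : lie (J x) (J y) = lie x y.
Proof. by case: abJ. Qed.

Lemma lieJl x y : lie (J x) y = - lie x (J y).
Proof. by rewrite -lieJJ JJ lieNl. Qed.

(** x - i J x and x + i J x lie in the eigenspaces of [J] for i and -i, that is in g^{1,0} and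
    g^{0,1}. *)
Let P x : g * g := (x, - J x).
Let Q x : g * g := (x, J x).

Let clieP x y : clie (P x) (P y) = 0.
Proof.
congr pair; rewrite /= !(lieNl, lieNr) ?lieJJ ?lieJl; first by vect_ring.
by rewrite opprK addNr.
Qed.

Let clieQ x y : clie (Q x) (Q y) = 0.
Proof. by congr pair; rewrite /= ?lieJJ ?lieJl ?subrr. Qed.

(** Doubling [a] avoids the factor 1/2 in the projections. *)
Let PQ_split (a : g * g) : exists x y, a + a = P x + Q y.
Proof.
case: a => v w; exists (v + J w), (v - J w).
congr pair; rewrite /=; first by vect_ring.
rewrite [J (v - _)]linearB [J (v + _)]linearD /= !JJ.
by vect_ring.
Qed.

Let double_eq0 (a : g * g) : a + a = 0 -> a = 0.
Proof.
move=> /eqP; rewrite -mulr2n -scaler_nat scaler_eq0 pnatr_eq0 /=.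
by move/eqP.
Qed.

(* The summands P and Q of the complexification are abelian subalgebras;
   this is the computation of Ito's theorem. *)
Let clie_ito x y z w :
  clie (clie (P x) (Q y)) (clie (P z) (Q w)) = 0.
Proof.
have [x1 [y1 E1]] := PQ_split (clie (Q y) (P z)).
have [x2 [y2 E2]] := PQ_split (clie (P x) (Q w)).
(* By Jacobi the goal's left side is [clie (P x) b - clie (Q y) a], with [a] as below; four times
   either term is [clie (P x1) (Q y2)]. *)
set b := clie (Q y) (clie (P z) (Q w)).
have bE : b + b = clie (P x1) (Q w).
  have -> : b = clie (clie (Q y) (P z)) (Q w).
    by rewrite clieA clieQ clie0r subr0.
  by rewrite -clieDl E1 clieDl clieQ addr0.
set a := clie (P x) (clie (P z) (Q w)).
have aE : a + a = clie (P z) (Q y2).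
  have -> : a = clie (P z) (clie (P x) (Q w)).
    by apply/eqP; rewrite -subr_eq0 -clieA clieP clie0l.
  by rewrite -clieDr E2 clieDr clieP add0r.
have xbE : clie (P x) (b + b) + clie (P x) (b + b) = clie (P x1) (Q y2).
  rewrite bE.
  have -> : clie (P x) (clie (P x1) (Q w)) = clie (P x1) (clie (P x) (Q w)).
    by apply/eqP; rewrite -subr_eq0 -clieA clieP clie0l.
  by rewrite -clieDr E2 clieDr clieP add0r.
have yaE : clie (Q y) (a + a) + clie (Q y) (a + a) = clie (P x1) (Q y2).
  rewrite aE.
  have -> : clie (Q y) (clie (P z) (Q y2)) = clie (clie (Q y) (P z)) (Q y2).
    by rewrite clieA clieQ clie0r subr0.
  by rewrite -clieDl E1 clieDl clieQ addr0.
apply/double_eq0/double_eq0; rewrite clieA -/a -/b.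
rewrite -[RHS](subrr (clie (P x1) (Q y2))) -{1}xbE -yaE !clieDr.
by vect_ring.
Qed.

Let lie_lie_J x y z w : lie (lie x y) (lie z w) = lie (lie x (J y)) (lie z (J w)).
Proof.
have PQE u v : clie (P u) (Q v) = (lie u v + lie u v, lie u (J v) + lie u (J v)).
  by congr pair; rewrite /= ?lieNl ?lieJJ ?lieJl ?opprK.
have := clie_ito x y z w; rewrite !PQE => /(congr1 fst) /=.
rewrite !(lieDl, lieDr) => /eqP; rewrite subr_eq0 => /eqP E.
apply/eqP; rewrite -subr_eq0; apply/eqP.
have d0 (u : g) : u + u = 0 -> u = 0.
  by move=> /eqP; rewrite -mulr2n -scaler_nat scaler_eq0 pnatr_eq0 => /eqP.
apply/d0/d0; set s := lie _ _ in E *; set t := lie _ _ in E *.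
transitivity (s + s + (s + s) - (t + t + (t + t))); first by vect_ring.
by rewrite E subrr.
Qed.

(** Exchanging [z] and [w] changes the sign of [lie z w] but fixes [lie z (J w)], so [lie_lie_J]
    equates the double bracket with its negative. *)
Lemma lie_metabelian x y z w : lie (lie x y) (lie z w) = 0.
Proof.
have := lie_lie_J x y w z.
rewrite [lie w z]lieC [lie w _]lieC lieJl opprK lieNr -lie_lie_J.
move=> /eqP; rewrite eq_sym -subr_eq0 opprK -mulr2n -scaler_nat.
by rewrite scaler_eq0 pnatr_eq0 => /eqP.
Qed.

End AbelianComplexStructure.

Import passmx.

(** * Wedderburn decomposition of a commutative associative algebra *)

Section CommutativeAlgebra.
Variables (F : numFieldType) (V : vectType F) (L : {linear V -> 'End(V)}).
Variable A : {vspace V}.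

(** The iterate is the power u^(k+1); it starts from [u] as there may be no unit. *)
Definition nilpotent_op (u : V) := exists k, iter k (L u) u = 0.

Let closed (U : {vspace V}) := mul_closed (fun u v : V => L u v) U.

Hypothesis closedA : closed A.
Hypothesis LC : forall u v : V, u \in A -> v \in A -> L u v = L v u.
Hypothesis LA : forall u v w : V, u \in A -> v \in A -> L (L u v) w = L v (L u w).

Lemma iter_mul_closed u k : u \in A -> iter k (L u) u \in A.
Proof. by move=> Au; elim: k => //= k IHk; apply: closedA. Qed.

Lemma mul_iter u k w : u \in A -> L (iter k (L u) u) w = iter k.+1 (L u) w.
Proof.
move=> Au; elim: k w => // k IHk w.
by rewrite [in LHS]iterS LA ?iter_mul_closed // IHk -iterSr.
Qed.

(* The last hypothesis says M = M * M. Take x in M such that x * M is nonzero of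
   minimal dimension: some y in M maps x * M onto itself, so is not nilpotent. *)
Lemma nil_algebra_idempotent_eq0 (M : {vspace V}) : (M <= A)%VS ->
  closed M -> (forall u, u \in M -> nilpotent_op u) ->
  (forall W : {vspace V}, (forall u v, u \in M -> v \in M -> L u v \in W) ->
     (M <= W)%VS) ->
  M = 0%VS.
Proof.
move=> /subvP MA closedM nilM genM; apply: contrapT => M0.
pose Q d :=
  `[< exists x, [/\ x \in M, (L x @: M)%VS <> 0%VS & \dim (L x @: M) = d] >].
have exQ : exists d, Q d.
  have [x [Mx x0]] : exists x, x \in M /\ (L x @: M)%VS <> 0%VS.
    apply: contrapT => nx; apply: M0; apply/eqP; rewrite -subv0.
    apply: genM => u v Mu Mv; have -> : 0%VS = (L u @: M)%VS.
      by apply: contrapT => u0; apply: nx; exists u; split=> // /esym.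
    exact: memv_img.
  by exists (\dim (L x @: M)); apply/asboolP; exists x.
case: (ex_minnP exQ) => d /asboolP[x [Mx x0 dx]] mind.
set I := (L x @: M)%VS in x0 dx.
have [y [My y0]] : exists y, y \in M /\ exists2 z, z \in M & L x (L y z) <> 0.
  apply: contrapT => ny; apply: x0; apply/eqP; rewrite -subv0 /I.
  have /subvP kx : (M <= lker (L x))%VS.
    apply: genM => u v Mu Mv; rewrite memv_ker; apply/eqP.
    by apply: contrapT => uv; apply: ny; exists u; split=> //; exists v.
  apply/subvP => _ /memv_imgP[w /kx + ->]; rewrite memv_ker => /eqP->.
  exact: mem0v.
have [Ax Ay] := (MA x Mx, MA y My).
have Myx : L y x \in M by apply: closedM.
have sI : (L (L y x) @: M <= I)%VS.
  apply/subvP => _ /memv_imgP[w Mw ->]; rewrite LA //.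
  by apply: memv_img; apply: closedM.
have eqI : (L (L y x) @: M)%VS = I.
  apply/eqP; rewrite eqEdim sI dx; apply: mind; apply/asboolP.
  exists (L y x); split=> // yx0; case: y0 => z Mz; apply.
  by apply/eqP; rewrite -LA // -memv0 -yx0 memv_img.
have surj k i : i \in I -> exists2 j, j \in I & i = iter k (L y) j.
  elim: k i => [|k IHk] i Ii; first by exists i.
  have [j Ij ->] := IHk i Ii; move: Ij; rewrite -{1}eqI => /memv_imgP[w Mw ->].
  exists (L x w); first exact: memv_img.
  by rewrite (LC Ay Ax) LA // -iterSr.
have [k yk] := nilM y My.
apply: x0; apply/eqP; rewrite -subv0; apply/subvP => i /(surj k.+1)[j _ ->].
by rewrite -mul_iter // yk linear0 lfunE mem0v.
Qed.

Variables (C : closedFieldType) (f : {rmorphism F -> C}).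

Let E := vbasis {:V}.
Let Eb : basis_of {:V} E := vbasisP _.

(* Multiplication operators of the algebra with a unit adjoined; without the
   first row this representation would not be faithful. *)
Let phi (u : V) : 'M[F]_(1 + \dim {:V}) :=
  block_mx 0 (rVof E u) 0 (mxof E E (L u)).

Let phi_linear : linear phi.
Proof.
move=> a u v; rewrite /phi scale_block_mx add_block_mx !linearP /=.
by rewrite !scaler0 !addr0.
Qed.

HB.instance Definition _ := GRing.isLinear.Build F V _ _ phi phi_linear.

Let phi_inj : injective phi.
Proof.
by move=> u v /eq_block_mx[_ uv _ _]; apply: (can_inj (rVofK Eb)).
Qed.

Let phiM u v : u \in A -> v \in A -> phi (L u v) = phi u * phi v.
Proof.
move=> Au Av; rewrite /phi -[RHS]/(_ *m _) mulmx_block.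
rewrite !mulmx0 !mul0mx !addr0 !add0r.
rewrite -rVof_app // LC // -mxof_comp //; congr (block_mx _ _ _ (mxof _ _ _)).
by apply/lfunP => w; rewrite comp_lfunE LC ?LA // LC.
Qed.

Let phiC u v : u \in A -> v \in A -> phi u * phi v = phi v * phi u.
Proof. by move=> Au Av; rewrite -!phiM // LC. Qed.

Let phi_iter u k : u \in A -> phi (iter k (L u) u) = phi u ^+ k.+1.
Proof.
move=> Au; elim: k => [|k IHk]; first by rewrite expr1.
by rewrite /= phiM ?iter_mul_closed // IHk -exprS.
Qed.

Let nilpP u : u \in A -> nilpotent_op u <-> nilpotent_elt phi u.
Proof.
move=> Au; split=> -[k uk].
  by exists k.+1; rewrite -phi_iter // uk linear0.
exists k; apply: phi_inj; rewrite phi_iter // exprS uk mulr0 linear0 //.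
Qed.

Theorem commutative_wedderburn : exists (S N : {vspace V}) (e : V),
  [/\ forall u, u \in N <-> u \in A /\ nilpotent_op u,
      [/\ (S <= A)%VS, closed S, (S + N)%VS = A & (S :&: N)%VS = 0%VS],
      e \in S /\ (forall u, u \in A -> u - L e u \in N)
    & forall U : {vspace V}, (U <= A)%VS -> closed U ->
        (U :&: N)%VS = 0%VS -> (U <= S)%VS].
Proof.
have [N NP] : exists N : {vspace V}, forall u,
    u \in N <-> u \in A /\ nilpotent_elt phi u.
  apply: vspace_of_Prop => [|a u v [Au nu] [Av nv]].
    by split; [exact: mem0v | exists 1%N; rewrite linear0].
  by split; [rewrite memvD ?memvZ | exact: (nilpotent_eltP phiC a Au Av nu nv)].
have [S SP] : exists S : {vspace V}, forall u,
    u \in S <-> u \in A /\ semisimple_elt f phi u.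
  apply: vspace_of_Prop => [|a u v [Au nu] [Av nv]].
    by split; [exact: mem0v | rewrite /semisimple_elt linear0; exact: semisimple0].
  by split; [rewrite memvD ?memvZ | exact: (semisimple_eltP phiC a Au Av nu nv)].
have SA : (S <= A)%VS by apply/subvP => u /SP[].
have SN0 : (S :&: N)%VS = 0%VS.
  apply/eqP; rewrite -subv0; apply/subvP => u; rewrite memv_cap.
  move=> /andP[/SP[_ su] /NP[_ nu]].
  by rewrite (semisimple_nilpotent_elt_eq0 phi_inj su nu) mem0v.
have [e [Ae ee eN]] := principal_idempotent closedA phiM phiC.
exists S, N, e; split.
- move=> u; rewrite NP; split=> -[Au nu]; split=> //; exact/nilpP.
- split=> //.
    move=> u v /SP[Au su] /SP[Av sv]; apply/SP; split; first exact: closedA.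
    exact: (semisimple_elt_mul phiM phiC Au Av su sv).
  apply/eqP; rewrite eqEsubv subv_add SA /=; apply/andP; split.
    by apply/subvP => u /NP[].
  apply/subvP => u Au.
  have [s [As ss ns]] := jordan_chevalley_elt f phiM (subvv A) closedA Au.
  rewrite -(subrK s u) addrC memv_add //; first by apply/SP.
  by apply/NP; rewrite memvB.
- split; last first.
    by move=> u Au; apply/NP; rewrite memvB ?closedA //; split=> //; apply: eN.
  apply/SP; split=> //.
  (* An idempotent is a root of X (X - 1), which is separable. *)
  apply: (@separable_semisimple _ _ _ _ _ (\prod_(x <- [:: 0; 1]) ('X - x%:P))).
    by rewrite separable_prod_XsubC /= inE eq_sym oner_eq0.
  rewrite !big_cons big_nil mulr1 rmorphM !rmorphB /= horner_mx_X !horner_mx_C.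
  by rewrite raddf0 subr0 mulrBr mulr1 ee subrr.
move=> U UA cU UN; apply/subvP => u Uu.
have [s [Us ss ns]] := jordan_chevalley_elt f phiM UA cU Uu.
have : u - s \in (U :&: N)%VS.
  by rewrite memv_cap memvB //=; apply/NP; rewrite (subvP UA) ?memvB.
rewrite UN memv0 subr_eq0 => /eqP ->.
by apply/SP; rewrite (subvP UA).
Qed.

End CommutativeAlgebra.

(** * The commutative algebra on the derived algebra, and J-solvability *)

Section Levi.
Variables (F : numFieldType) (C : closedFieldType) (f : {rmorphism F -> C}).
Variables (g : lieAlgType F) (J : 'End(g)).
Hypothesis abJ : abelian_complex_structure J.
Implicit Types (x y z u v w : g) (U W h k : {vspace g}).

Let A : {vspace g} := liev fullv fullv.

Let lie_A x y : lie x y \in A.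
Proof. by apply: memv_liev; rewrite memvf. Qed.

Let lie_AA u v : u \in A -> v \in A -> lie u v = 0.
Proof.
have lker_lie x : (forall y z, lie x (lie y z) = 0) ->
    (A <= lker (linfun (lie x)))%VS.
  move=> x0; apply/liev_subP => y z _ _.
  by rewrite memv_ker lfunE /= x0.
move=> Au Av; suff /lker_lie/subvP/(_ v Av) : forall y z, lie u (lie y z) = 0.
  by rewrite memv_ker lfunE => /eqP.
move=> y z; rewrite lieC; apply/eqP; rewrite oppr_eq0.
have /lker_lie/subvP/(_ u Au) : forall y' z', lie (lie y z) (lie y' z') = 0.
  exact: lie_metabelian abJ _ _.
by rewrite memv_ker lfunE.
Qed.

Let adC x y u : u \in A -> lie x (lie y u) = lie y (lie x u).
Proof. by move=> Au; apply/eqP; rewrite -subr_eq0 -lieA lie_AA. Qed.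

(* The product u * v of the header. *)
Definition adJ u : 'End(g) := linfun (lie (J u)).

Let adJE u v : adJ u v = lie (J u) v.
Proof. by rewrite lfunE. Qed.

Lemma adJ_linear : linear adJ.
Proof.
move=> a u v; apply/lfunP => w.
by rewrite add_lfunE scale_lfunE !adJE linearP /= lieDl lieZl.
Qed.

HB.instance Definition _ := GRing.isLinear.Build F g _ _ adJ adJ_linear.

Let adJ_comm u v : adJ u v = adJ v u.
Proof. by rewrite !adJE lieJl // [RHS]lieC. Qed.

Let closedA : mul_closed (fun u v : g => adJ u v) A.
Proof. by move=> u v _ _; rewrite adJE. Qed.

Let LC u v : u \in A -> v \in A -> adJ u v = adJ v u.
Proof. by []. Qed.

Let LA u v w : u \in A -> v \in A -> adJ (adJ u v) w = adJ v (adJ u w).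
Proof.
move=> Au Av; rewrite adJ_comm (adJ_comm u v) !adJE adC //.
by rewrite -!adJE (adJ_comm w).
Qed.

(** Since [lie x] commutes with multiplications on [A], the n-th power of [lie x u] is the n-th
    iterate of [lie x] at the n-th power of [u]. This makes the nilradical an ideal of [g]. *)
Lemma nilpotent_lie x u :
  u \in A -> nilpotent_op adJ u -> nilpotent_op adJ (lie x u).
Proof.
move=> Au [k uk]; exists k.
have iterA v j : v \in A -> iter j (lie x) v \in A.
  by case: j => // j; rewrite /= lie_A.
have adJ_iter v w j : w \in A ->
    adJ v (iter j (lie x) w) = iter j (lie x) (adJ v w).
  move=> Aw; elim: j => //= j <-; rewrite !adJE adC ?iterA //.
have -> j : iter j (adJ (lie x u)) (lie x u) = iter j.+1 (lie x) (iter j (adJ u) u).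
  elim: j => // j IHj; rewrite iterS IHj adJ_comm adJE adC // -adJE adJ_comm.
  by rewrite adJ_iter ?(iter_mul_closed closedA).
by rewrite uk; elim: k.+1 => //= j ->; rewrite linear0.
Qed.

Lemma Jderived_inv U j : Jinvariant J U -> Jinvariant J (Jderived J U j).
Proof.
case: j => // j _; rewrite /Jinvariant /= limgD subv_add addvSr /=.
apply: subv_trans (addvSl _ _).
apply/subvP => _ /memv_imgP[_ /memv_imgP[u Du ->] ->].
by rewrite JJ // memvN.
Qed.

(** The square [lie (J v) v] of an element of one term of the series lies in the next, so repeated
    squaring of [u] reaches 0. *)
Lemma Jsolvable_nilpotent U u : Jinvariant J U -> Jsolvable J U ->
  u \in U -> u \in A -> nilpotent_op adJ u.
Proof.
move=> JU [j Uj] Uu Au.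
suff [m] : exists m, iter m (adJ u) u \in Jderived J U j.
  by rewrite Uj memv0 => /eqP um; exists m.
elim: {Uj}j => [|j [m um]]; first by exists 0%N.
(* [iter m] is the power m + 1, whose square is the power 2m + 2. *)
exists (m + m.+1)%N; rewrite addnC iterD -(mul_iter closedA LA) // adJE.
apply: (subvP (addvSl _ _)); apply: memv_liev => //.
exact: (subvP (Jderived_inv j JU)) (memv_img _ um).
Qed.

(** A J-solvable ideal [k] of [h] yields the J-solvable ideal [k + JRad J] of [g]; maximality of the
    radical then forces [k] into its zero intersection with [h]. *)
Lemma semidirect_Jsemisimple h :
  semidirect J h (JRad J) -> Jsemisimple J h.
Proof.
case=> subh ir hr hIr; split=> // k [/and3P[kh Jk /liev_subP ik] [m km]].
have [[/and3P[_ Jr /liev_subP lr] [n rn]] maxr] := JRadP J.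
suff kr : (k <= JRad J)%VS.
  by apply/eqP; rewrite -subv0 -hIr subv_cap kh.
apply: subv_trans (addvSl k (JRad J)) _; apply: maxr; split.
  apply/and3P; split; first exact: subvf.
    by rewrite /Jinvariant limgD; apply: addvS.
  apply/liev_subP => x _ _ /memv_addP[a ka [b rb ->]].
  have /memv_addP[y hy [z rz ->]] : x \in (h + JRad J)%VS by rewrite hr memvf.
  rewrite lieDr lieDl -addrA memv_add //; first exact: ik.
  rewrite memvD //; first by rewrite lieC memvN lr ?memvf.
  by rewrite lr ?memvf.
exists (m + n)%N; rewrite Jderived_add.
have sr : (Jderived J (k + JRad J) m <= JRad J)%VS.
  by have := Jderived_addv k m ir; rewrite km add0v.
by have := JderivedS J n sr; rewrite rn subv0 => /eqP.
Qed.


Lemma Jderived_subS U j : Jinvariant J U -> (liev U U <= U)%VS ->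
  (Jderived J U j.+1 <= Jderived J U j)%VS.
Proof.
move=> JU lU; rewrite -add1n Jderived_add; apply: JderivedS.
by rewrite /= subv_add lU (subv_trans (limgS J lU)).
Qed.

Lemma Jderived_sub U j : Jinvariant J U -> (liev U U <= U)%VS ->
  (Jderived J U j <= U)%VS.
Proof.
by move=> JU lU; elim: j => // j; apply: subv_trans (Jderived_subS _ JU lU).
Qed.

Lemma Jderived_stationary U : Jinvariant J U -> (liev U U <= U)%VS ->
  exists j, Jderived J U j.+2 = Jderived J U j.+1.
Proof.
move=> JU lU.
pose P d := `[< exists j, \dim (Jderived J U j.+1) = d >].
have exP : exists d, P d.
  by exists (\dim (Jderived J U 1)); apply/asboolP; exists 0%N.
case: (ex_minnP exP) => d /asboolP[j dj] mind; exists j.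
apply/eqP; rewrite eqEdim Jderived_subS // dj; apply: mind; apply/asboolP.
by exists j.+1.
Qed.

(* The J-derived series becomes stationary at D = M + JM with M = [D,D]; then M is
   an idempotent ideal M = M * M of nilpotent elements, hence zero. *)
Lemma derived_nilpotent_Jsolvable N U : (N <= A)%VS ->
  (forall u, u \in N -> nilpotent_op adJ u) ->
  (forall x u, u \in N -> lie x u \in N) ->
  Jinvariant J U -> (liev U U <= U)%VS -> (liev U U <= N)%VS -> Jsolvable J U.
Proof.
move=> /subvP NA nilN idN JU lU UN.
have [j DE] := Jderived_stationary JU lU; exists j.+1.
set D := Jderived J U j.+1 in DE *; set M := liev D D.
have DM : D = (M + J @: M)%VS by rewrite -[LHS]DE.
have DU : (D <= U)%VS by apply: Jderived_sub.
have MN : (M <= N)%VS.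
  apply: subv_trans UN; apply/liev_subP => u v /(subvP DU) Uu /(subvP DU).
  exact: memv_liev.
have /subvP MD : (M <= D)%VS by rewrite DM addvSl.
have JMD u : u \in M -> J u \in D.
  by move=> Mu; rewrite DM (subvP (addvSr _ _)) ?memv_img.
have M0 : M = 0%VS.
  apply: (nil_algebra_idempotent_eq0 closedA LC LA).
  - by apply/subvP => u /(subvP MN)/NA.
  - by move=> u v Mu Mv; rewrite adJE; apply: memv_liev; [apply: JMD | apply: MD].
  - by move=> u /(subvP MN)/nilN.
  move=> W WM; apply/liev_subP => x y; rewrite DM.
  move=> /memv_addP[a Ma [_ /memv_imgP[b Mb ->] ->]].
  move=> /memv_addP[c Mc [_ /memv_imgP[d Md ->] ->]].
  have MA w : w \in M -> w \in A by move=> /(subvP MN)/NA.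
  (* The unmixed brackets vanish because [A] is abelian; the mixed ones are products of elements of
     [M], up to sign. *)
  rewrite !(lieDl, lieDr) lieJJ //.
  rewrite (lie_AA (MA a Ma) (MA c Mc)) (lie_AA (MA b Mb) (MA d Md)).
  rewrite add0r addr0 lieC -!adJE.
  by rewrite memvD ?memvN ?WM.
by rewrite DM M0 limg0 addv0.
Qed.

(** * Existence and uniqueness of the complement of the radical *)

Section Decomposition.
Variables (S N : {vspace g}) (e : g).
Hypothesis NP : forall u, u \in N <-> u \in A /\ nilpotent_op adJ u.
Hypothesis SA : (S <= A)%VS.
Hypothesis closedS : mul_closed (fun u v : g => adJ u v) S.
Hypothesis SN : (S + N)%VS = A.
Hypothesis SN0 : (S :&: N)%VS = 0%VS.
Hypothesis Se : e \in S.
Hypothesis eN : forall u, u \in A -> u - adJ e u \in N.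
Hypothesis maxS : forall U, (U <= A)%VS -> mul_closed (fun u v : g => adJ u v) U ->
  (U :&: N)%VS = 0%VS -> (U <= S)%VS.

Let Ae : e \in A. Proof. exact: subvP SA _ Se. Qed.

Let lieN x u : u \in N -> lie x u \in N.
Proof. by move=> /NP[Au nu]; apply/NP; split=> //; apply: nilpotent_lie. Qed.

(** Stability under [lie y] follows from Jacobi and commutation on [A]. For [u] in [k,k], both
    [u - e * u] and [e * u = lie (J e) u] lie in [N], so [k,k] is contained in [N] and
    [derived_nilpotent_Jsolvable] applies. *)
Lemma nil_centralizer_Jsolvable_ideal k :
  (forall x, x \in k <-> forall u, u \in A -> lie u x \in N /\ lie (J u) x \in N) ->
  Jsolvable_ideal J fullv k.
Proof.
move=> kP.
have Jk : Jinvariant J k.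
  apply/subvP => _ /memv_imgP[x /kP kx ->]; apply/kP => u /kx[ux Jux].
  by rewrite lieJJ // -[lie u _]opprK -lieJl // memvN.
have ik : (liev fullv k <= k)%VS.
  apply/liev_subP => y x _ /kP kx; apply/kP => u Au; have [ux Jux] := kx u Au.
  rewrite (lie_AA Au) ?mem0v //; split=> //.
  have -> : lie (J u) (lie y x) = lie (lie (J u) y) x + lie y (lie (J u) x).
    by rewrite lieA subrK.
  rewrite -{1}adJE adJ_comm adJE memvD ?(lieN _ Jux) // lieC memvN adC // lieN //.
  by rewrite lieC memvN.
split; first by rewrite /Jideal subvf Jk.
have lk : (liev k k <= k)%VS.
  apply: subv_trans ik; apply/liev_subP => x y _.
  by apply: memv_liev; rewrite memvf.
apply: (@derived_nilpotent_Jsolvable N) => //.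
- by apply/subvP => u /NP[].
- by move=> u /NP[].
apply/liev_subP => x y kx ky; set u := lie x y.
have /kP/(_ e Ae)[_ eu] : u \in k by apply: (subvP lk); apply: memv_liev.
rewrite -(subrK (adJ e u) u) memvD ?adJE // -adJE.
exact/eN/lie_A.
Qed.

Let r := JRad J.

Let r_ideal x y : y \in r -> lie x y \in r.
Proof.
have [[/and3P[_ _ /liev_subP ir] _] _] := JRadP J.
by apply: ir; rewrite memvf.
Qed.

Let Jr : Jinvariant J r.
Proof. by have [[/and3P[]]] := JRadP J. Qed.

Let rA u : u \in r -> u \in A -> u \in N.
Proof.
move=> ru Au; apply/NP; split=> //; have [[_ sr] _] := JRadP J.
exact: Jsolvable_nilpotent Jr sr ru Au.
Qed.

Let kr x : (forall u, u \in A -> lie u x \in N /\ lie (J u) x \in N) -> x \in r.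
Proof.
have [k kP] : exists k, forall x, x \in k <->
    forall u, u \in A -> lie u x \in N /\ lie (J u) x \in N.
  apply: vspace_of_Prop => [u Au|a v w vN wN u Au].
    by rewrite !linear0 mem0v.
  have [[v1 v2] [w1 w2]] := (vN u Au, wN u Au).
  by rewrite !linearP /= !memvD ?memvZ.
move/kP; have [_ maxr] := JRadP J.
exact/subvP/maxr/nil_centralizer_Jsolvable_ideal.
Qed.

Let Nr : (N <= r)%VS.
Proof. by apply/subvP => u Nu; apply: kr => v _; split; apply: lieN. Qed.

Let es s : s \in S -> lie (J e) s = s.
Proof.
move=> Ss; have : s - adJ e s \in (S :&: N)%VS.
  by rewrite memv_cap eN ?(subvP SA) // andbT memvB ?closedS.
by rewrite SN0 memv0 subr_eq0 adJE => /eqP <-.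
Qed.

Let h := (S + J @: S)%VS.

Lemma Levi_subalgebra_semidirect : semidirect J h r.
Proof.
have [[idr _] _] := JRadP J.
have Jh : Jinvariant J h.
  rewrite /Jinvariant limgD subv_add addvSr /=; apply: subv_trans (addvSl _ _).
  by apply/subvP => _ /memv_imgP[_ /memv_imgP[u Su ->] ->]; rewrite JJ // memvN.
have /subvP Sh : (S <= h)%VS := addvSl _ _.
split=> //.
- rewrite /Jsubalgebra Jh /=; apply/liev_subP => x y.
  move=> /memv_addP[a Sa [_ /memv_imgP[b Sb ->] ->]].
  move=> /memv_addP[c Sc [_ /memv_imgP[d Sd ->] ->]].
  have SA' w : w \in S -> w \in A by exact: subvP SA _.
  rewrite !(lieDl, lieDr) lieJJ //.
  rewrite (lie_AA (SA' a Sa) (SA' c Sc)) (lie_AA (SA' b Sb) (SA' d Sd)).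
  by rewrite add0r addr0 lieC -!adJE; apply: Sh; rewrite memvD ?memvN ?closedS.
- apply/eqP; rewrite eqEsubv subvf /=; apply/subvP => x _.
  set a := lie (J e) x; set b := lie e x.
  have AD u : u \in A -> u \in (S + r)%VS.
    by rewrite -SN; apply/subvP/addvS.
  have JAD u : u \in A -> J u \in (h + r)%VS.
    move=> /AD/memv_addP[s Ss [n rn ->]]; rewrite linearD memv_add //=.
      by apply: (subvP (addvSr _ _)); apply: memv_img.
    exact: (subvP Jr) (memv_img _ rn).
  have -> : x = a - J b + (x - a + J b) by vect_ring.
  have Shr : (S + r <= h + r)%VS by rewrite addvS ?addvSl.
  rewrite memvD //; first by rewrite memvB ?JAD ?lie_A // (subvP Shr) ?AD ?lie_A.
  apply: (subvP (addvSr _ _)); apply: kr => u Au.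
  (* The two required memberships in [N] are this identity at [y = x] and at [y = J x]. *)
  have E1 y : lie u y - lie (J u) (lie e y) = - lie y (u - adJ e u).
    rewrite lieDr lieNr adJ_comm adJE -(adC _ _ Ae) [lie u y]lieC [lie e y]lieC.
    by rewrite lieNr opprD opprK.
  have Nu y : lie u y - lie (J u) (lie e y) \in N.
    by rewrite E1 memvN lieN // eN.
  rewrite !(lieDr, lieNr) (lie_AA Au (lie_A _ _)) lieJJ // (lie_AA Au (lie_A _ _)).
  rewrite subr0 addr0 -[lie u (J b)]opprK -lieJl //; split; first exact: Nu.
  by rewrite /a !(lieJl abJ _ x) lieNr -opprD memvN Nu.
- apply/eqP; rewrite -subv0; apply/subvP => x; rewrite memv_cap => /andP[].
  move=> /memv_addP[a Sa [_ /memv_imgP[b Sb ->] ->]] rx.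
  have [Aa Ab] := (subvP SA _ Sa, subvP SA _ Sb).
  have SN_eq0 s : s \in S -> s \in r -> s = 0.
    move=> Ss rs; apply/eqP; rewrite -memv0 -SN0 memv_cap Ss rA //.
    exact: subvP SA _ Ss.
  (* Bracketing [a + J b] with [J e] isolates [a], and with [e] isolates [- b]; both results lie in
     S and the radical, hence in N. *)
  have a0 : a = 0.
    apply: SN_eq0 => //; have := r_ideal (J e) rx.
    by rewrite lieDr lieJJ // (lie_AA Ae Ab) addr0 (es Sa).
  have b0 : b = 0.
    apply: SN_eq0 => //; have := r_ideal e rx.
    by rewrite lieDr (lie_AA Ae Aa) add0r -[lie e _]opprK -lieJl // (es Sb) memvN.
  by rewrite a0 b0 linear0 addr0 mem0v.
Qed.

Lemma Levi_subalgebra_unique h' : semidirect J h' r -> h' = h.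
Proof.
have [_ _ hr hIr] := Levi_subalgebra_semidirect.
case=> /andP[Jh' /liev_subP lh'] _ hr' hIr'.
(* Two complements of [r] have equal dimension, so one inclusion suffices. *)
suff sS : (S <= h')%VS.
  apply/esym/eqP; rewrite eqEdim subv_add sS (subv_trans (limgS J sS)) //=.
  by rewrite -(leq_add2r (\dim r)) -!dimv_disjoint_sum // hr hr'.
have /subvP Ah : (A <= liev h' h' + r)%VS.
  apply/liev_subP => x y; rewrite -hr'.
  move=> /memv_addP[a ha [b rb ->]] /memv_addP[c hc [d rd ->]].
  rewrite !lieDl lieDr -addrA memv_add ?memv_liev // memvD ?(r_ideal a rd) //.
  by rewrite lieC memvN r_ideal.
(* [h',h'] is a subalgebra for the product and meets [N] inside the zero intersection of [h'] and
   [r], so it is reduced. *)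
have /subvP BS : (liev h' h' <= S)%VS.
  apply: maxS.
  - by apply/liev_subP => x y _ _; apply: lie_A.
  - move=> u v; rewrite adJE; have lh : (liev h' h' <= h')%VS by apply/liev_subP.
    move=> /(subvP lh) hu /(subvP lh) hv; apply: memv_liev => //.
    exact: (subvP Jh') (memv_img _ hu).
  apply/eqP; rewrite -subv0 -hIr'; apply: capvS => //.
  exact/liev_subP.
apply/subvP => s Ss; have As := subvP SA _ Ss.
have /memv_addP[b Bb [n rn sE]] := Ah s As.
have Sb := BS b Bb; have nE : n = s - b by rewrite sE addrC addKr.
have : n \in (S :&: N)%VS.
  rewrite memv_cap rA ?andbT //; first by rewrite nE memvB.
  by rewrite nE memvB // (subvP SA).
rewrite SN0 memv0 sE => /eqP->; rewrite addr0.
by move: Bb; apply/subvP/liev_subP.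
Qed.

End Decomposition.

Lemma Levi_decomposition : exists! h, semidirect J h (JRad J).
Proof.
have [S [N [e [NP [SA cS SN SN0] [Se eN] maxS]]]] :=
  commutative_wedderburn closedA LC LA f.
exists (S + J @: S)%VS; split.
  exact: (Levi_subalgebra_semidirect NP SA cS SN SN0 Se eN).
by move=> h' /(Levi_subalgebra_unique NP SA cS SN SN0 Se eN maxS) ->.
Qed.

End Levi.

Theorem theorem1 (R : realType) (g : lieAlgType R) (J : 'End(g)) :
  abelian_complex_structure J ->
  exists! h : {vspace g}, Jsemisimple J h /\ semidirect J h (JRad J).
Proof.
move=> abJ.
(* Semisimplicity is tested over the complex numbers [R[i]]. *)
have [h [hP hU]] := Levi_decomposition (real_complex R) abJ.
exists h; split; first by split=> //; apply: semidirect_Jsemisimple.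
by move=> h' [_ /hU].
Qed.
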